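(* Let $f:\mathbb{R}^n\to\mathbb{R}$ be a quadratic function, and let $Q_{k-1}^+$ be the (previous) bivariate quadratic model as described in the context. If $Q_k$ is a solution of the problem $$\min_{Q}\ \int_{-\infty}^{\infty}\bigl(Q(\alpha,0)-Q_{k-1}^+(\alpha,0)\bigr)^2\,d\alpha\quad\text{subject to}\quad Q\bigl(\mathcal T(\boldsymbol z)\bigr)=f(\boldsymbol z)\ \ \forall\,\boldsymbol z\in\{\boldsymbol x_k,\boldsymbol y_1^{(k)},\boldsymbol y_2^{(k)},\boldsymbol y_3^{(k)}\},$$ where $Q$ ranges over real quadratic functions (polynomials of degree at most 2) of two variables $(\alpha,\beta)$, then $$\int_{-\infty}^{\infty}\bigl(Q_k(\alpha,0)-\tilde f(\alpha,0)\bigr)^2d\alpha\le\int_{-\infty}^{\infty}\bigl(Q_{k-1}^+(\alpha,0)-\tilde f(\alpha,0)\bigr)^2d\alpha,$$ where $\tilde f=f\circ\mathcal T^{-1}$, i.e. $\tilde f(\alpha,\beta)=f(\boldsymbol x_k+\alpha\boldsymbol d_1^{(k)}+\beta\boldsymbol d_2^{(k)})$.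
   Context: Fixed data: $\boldsymbol x_k\in\mathbb{R}^n$, $\Delta_k>0$, and orthonormal vectors $\boldsymbol d_1^{(k)},\boldsymbol d_2^{(k)}\in\mathbb{R}^n$. The map $\mathcal T=\mathcal T^{(k)}_{\boldsymbol d_1^{(k)},\boldsymbol d_2^{(k)}}$ sends $\boldsymbol y\in\boldsymbol x_k+\operatorname{span}\{\boldsymbol d_1^{(k)},\boldsymbol d_2^{(k)}\}$ to $(\langle\boldsymbol y-\boldsymbol x_k,\boldsymbol d_1^{(k)}\rangle,\langle\boldsymbol y-\boldsymbol x_k,\boldsymbol d_2^{(k)}\rangle)^\top\in\mathbb{R}^2$; it is a bijection. The interpolation points are $\boldsymbol y_1^{(k)}=\boldsymbol x_k+\Delta_k\boldsymbol d_2^{(k)}$; $\boldsymbol y_2^{(k)}=\boldsymbol x_k+2\Delta_k\boldsymbol d_2^{(k)}$ if $f(\boldsymbol y_1^{(k)})\le f(\boldsymbol x_k)$ and $\boldsymbol y_2^{(k)}=\boldsymbol x_k-\Delta_k\boldsymbol d_2^{(k)}$ otherwise; and $\boldsymbol y_3^{(k)}=\boldsymbol y_{\min}+\Delta_k\boldsymbol d_1^{(k)}$, where $\boldsymbol y_{\min}$ is a minimizer of $f$ over $\{\boldsymbol y_1^{(k)},\boldsymbol y_2^{(k)}\}$. $Q_{k-1}^+$ is a real polynomial of degree at most 2 in two variables with $Q_{k-1}^+(0,0)=f(\boldsymbol x_k)$; it is the model from the previous iteration of the method, obtained by interpolating $f$ at six points (for which quadratic interpolation is uniquely solvable) of the previous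 iteration's two-dimensional affine subspace, which contains $\boldsymbol x_k+\operatorname{span}\{\boldsymbol d_1^{(k)}\}$, written in coordinates in which the point $\boldsymbol x_k+\alpha\boldsymbol d_1^{(k)}$ corresponds to $(\alpha,0)$. Integrals of nonnegative functions over $\mathbb{R}$ take values in $[0,+\infty]$, with the usual extended-real arithmetic. *)

(* Defs.v *)
From mathcomp Require Import all_boot all_order all_algebra.
From mathcomp Require Import all_classical all_reals all_analysis.

Set Implicit Arguments.
Unset Strict Implicit.
Unset Printing Implicit Defensive.

Import Order.TTheory GRing.Theory Num.Theory.
Local Open Scope classical_set_scope.
Local Open Scope ring_scope.

Section Definitions.
Variable R : realType.

Section Space.
Variable n : nat.
Implicit Types (f : 'cV[R]_n -> R) (x y d : 'cV[R]_n) (Delta : R).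

Definition dot (u v : 'cV[R]_n) : R := \sum_i u i 0 * v i 0.

Definition orthonormal2 (d1 d2 : 'cV[R]_n) : Prop :=
  [/\ dot d1 d1 = 1, dot d2 d2 = 1 & dot d1 d2 = 0].

(* Polynomial functions of total degree at most 2; the degree may drop. *)
Definition quadratic f : Prop :=
  exists (A : 'M[R]_n) (b : 'cV[R]_n) (c : R),
    forall x, f x = dot x (A *m x) + dot b x + c.

Definition affine_plane x d1 d2 : set 'cV[R]_n :=
  [set y | y - x \in <<[:: d1; d2]>>%VS].

End Space.

Definition pair2 (a b : R) : 'cV[R]_2 := \col_(i < 2) [:: a; b]`_i.

(* For every choice of six values there is exactly one interpolating
   quadratic. *)
Definition unisolvent6 (u : 'I_6 -> 'cV[R]_2) : Prop :=
  forall v : 'I_6 -> R,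
    exists! Q : 'cV[R]_2 -> R, quadratic Q /\ forall i, Q (u i) = v i.

Section Iteration.
Variable n : nat.
Implicit Types (f : 'cV[R]_n -> R) (x y d : 'cV[R]_n) (Delta : R).

(* [phi] is the inverse of a system of affine coordinates on [S]: the
   point [phi u] of [S] has coordinates [u]. *)
Definition affine_param (S : set 'cV[R]_n) (phi : 'cV[R]_2 -> 'cV[R]_n) : Prop :=
  [/\ exists L : 'M[R]_(n, 2), forall u, phi u = phi 0 + L *m u,
      injective phi & range phi = S].

(* The plane x' + span{p1, p2} is the affine subspace of the previous
   iteration; the six interpolation points are the [phi (u i)]. *)
Definition previous_model f xk d1 (Qp : 'cV[R]_2 -> R) : Prop :=
  [/\ quadratic Qp, Qp (pair2 0 0) = f xk &
      exists (x' p1 p2 : 'cV[R]_n) (phi : 'cV[R]_2 -> 'cV[R]_n)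
             (u : 'I_6 -> 'cV[R]_2),
        [/\ orthonormal2 p1 p2,
            affine_param (affine_plane x' p1 p2) phi,
            forall alpha, phi (pair2 alpha 0) = xk + alpha *: d1,
            unisolvent6 u &
            forall i, Qp (u i) = f (phi (u i))]].

(* Only its values on [affine_plane xk d1 d2] matter, where it is a bijection
   onto R^2 when d1, d2 are orthonormal. *)
Definition Tmap xk d1 d2 (y : 'cV[R]_n) : 'cV[R]_2 :=
  pair2 (dot (y - xk) d1) (dot (y - xk) d2).

Definition ftilde f xk d1 d2 (alpha beta : R) : R :=
  f (xk + alpha *: d1 + beta *: d2).

Definition y1 xk Delta d2 : 'cV[R]_n := xk + Delta *: d2.

Definition y2 f xk Delta d2 : 'cV[R]_n :=
  if f (y1 xk Delta d2) <= f xk then xk + (2 * Delta) *: d2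
  else xk - Delta *: d2.

Definition minimizer_on f (S : set 'cV[R]_n) y : Prop :=
  S y /\ forall z, S z -> f y <= f z.

Definition y3 ymin Delta d1 : 'cV[R]_n := ymin + Delta *: d1.

Definition sample_points f xk Delta d1 d2 ymin : set 'cV[R]_n :=
  [set xk; y1 xk Delta d2; y2 f xk Delta d2; y3 ymin Delta d1].

Definition sqdist (g h : R -> R) : \bar R :=
  (\int[lebesgue_measure]_(alpha in [set: R]) (((g alpha - h alpha) ^+ 2)%:E))%E.

Definition feasible f xk Delta d1 d2 ymin (Q : 'cV[R]_2 -> R) : Prop :=
  quadratic Q /\
  forall z, sample_points f xk Delta d1 d2 ymin z -> Q (Tmap xk d1 d2 z) = f z.

Definition model_solution f xk Delta d1 d2 ymin (Qp Qk : 'cV[R]_2 -> R) : Prop :=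
  feasible f xk Delta d1 d2 ymin Qk /\
  forall Q, feasible f xk Delta d1 d2 ymin Q ->
    (sqdist (fun alpha => Qk (pair2 alpha 0)) (fun alpha => Qp (pair2 alpha 0)) <=
     sqdist (fun alpha => Q (pair2 alpha 0)) (fun alpha => Qp (pair2 alpha 0)))%E.

End Iteration.

End Definitions.

(* Main.v *)
(** Unisolvence forces the previous model to coincide with f on the whole
    previous plane, which contains the line [xk + alpha *: d1]; hence [Qp] and
    [ftilde] agree on the axis [beta = 0].  Since [ftilde] itself is feasible,
    the claimed inequality is the optimality of [Qk] tested against [ftilde]. *)
Require Import Defs.
From mathcomp Require Import all_boot all_order all_algebra.
From mathcomp Require Import all_classical all_reals all_analysis.
From mathcomp Require Import ring.

Set Implicit Arguments.
Unset Strict Implicit.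
Unset Printing Implicit Defensive.

Import Order.TTheory GRing.Theory Num.Theory.
Local Open Scope classical_set_scope.
Local Open Scope ring_scope.

Section QuadraticModels.
Variable R : realType.

Lemma dotC n (u v : 'cV[R]_n) : dot u v = dot v u.
Proof. by apply: eq_bigr => i _; rewrite mulrC. Qed.

Lemma dotDl n (u v w : 'cV[R]_n) : dot (u + v) w = dot u w + dot v w.
Proof. by rewrite -big_split; apply: eq_bigr => i _; rewrite mxE mulrDl. Qed.

Lemma dotDr n (u v w : 'cV[R]_n) : dot w (u + v) = dot w u + dot w v.
Proof. by rewrite dotC dotDl !(dotC w). Qed.

Lemma dotZl n (a : R) (u v : 'cV[R]_n) : dot (a *: u) v = a * dot u v.
Proof. by rewrite mulr_sumr; apply: eq_bigr => i _; rewrite mxE mulrA. Qed.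

(** The transpose is the adjoint for [dot]: written as the 1×1 product [s^T *m t], the identity is
    associativity. *)
Lemma dot_mulmxl m n (L : 'M[R]_(n, m)) (u : 'cV[R]_m) (v : 'cV[R]_n) :
  dot (L *m u) v = dot u (L^T *m v).
Proof.
have dotE k (s t : 'cV[R]_k) : dot s t = (s^T *m t) 0 0.
  by rewrite mxE; apply: eq_bigr => i _; rewrite mxE.
by rewrite !dotE trmx_mul mulmxA.
Qed.

Lemma quadratic_comp_affine m n (f : 'cV[R]_n -> R) (p : 'cV[R]_n)
    (L : 'M[R]_(n, m)) :
  quadratic f -> quadratic (fun u => f (p + L *m u)).
Proof.
move=> [A [b [c fE]]].
(* These are the coefficients of the expanded form. Since [A] may be nonsymmetric, the two cross
   terms contribute [A] and [A^T] separately to the linear part. *)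
exists (L^T *m A *m L), (L^T *m (A *m p) + L^T *m (A^T *m p) + L^T *m b),
  (dot p (A *m p) + dot b p + c) => u.
have pAL : dot p (A *m (L *m u)) = dot (L^T *m (A^T *m p)) u.
  by rewrite dotC 2!dot_mulmxl dotC.
have bL : dot b (L *m u) = dot (L^T *m b) u by rewrite dotC dot_mulmxl dotC.
have LAp : dot (L *m u) (A *m p) = dot (L^T *m (A *m p)) u.
  by rewrite dot_mulmxl dotC.
have LAL : dot (L *m u) (A *m (L *m u)) = dot u (L^T *m A *m L *m u).
  by rewrite dot_mulmxl !mulmxA.
rewrite fE mulmxDr !dotDl !dotDr pAL bL LAp LAL; ring.
Qed.

Lemma previous_model_axis n (f : 'cV[R]_n -> R) (xk d1 : 'cV[R]_n)
    (Qp : 'cV[R]_2 -> R) :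
  quadratic f -> previous_model f xk d1 Qp ->
  forall alpha, Qp (pair2 alpha 0) = f (xk + alpha *: d1).
Proof.
move=> fq [Qpq _ [x' [p1 [p2 [phi [u [_ [[L phiE] _ _] phid1 uni Qpu]]]]]]] a.
have [Q [_ Quniq]] := uni (fun i => f (phi (u i))).
have fphiq : quadratic (fun v => f (phi v)).
  have [A [b [c fE]]] := quadratic_comp_affine (phi 0) L fq.
  by exists A, b, c => v; rewrite phiE.
(* Both sides are quadratics taking the same six values, so each equals the unique interpolant
   [Q]. *)
have -> : Qp = fun v => f (phi v).
  by rewrite -(Quniq _ (conj Qpq Qpu)) (Quniq _ (conj fphiq (fun=> erefl))).
by rewrite phid1.
Qed.

Lemma pair2E0 (a b : R) : pair2 a b 0 0 = a. Proof. by rewrite mxE. Qed.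

Lemma pair2E1 (a b : R) : pair2 a b 1 0 = b. Proof. by rewrite mxE. Qed.

Lemma Tmap_plane n (xk d1 d2 : 'cV[R]_n) (a b : R) :
  orthonormal2 d1 d2 -> Tmap xk d1 d2 (xk + a *: d1 + b *: d2) = pair2 a b.
Proof.
move=> [d11 d22 d12]; rewrite /Tmap.
have -> : xk + a *: d1 + b *: d2 - xk = a *: d1 + b *: d2.
  by rewrite addrAC [X in X + _]addrAC subrr add0r.
by rewrite !dotDl !dotZl d11 d22 (dotC d2) d12 !mulr1 !mulr0 addr0 add0r.
Qed.

(** Bare existence of coordinates is enough for feasibility of [ftilde], because [ftilde] matches
    [f] on the whole plane. The branch taken in [y2] and the choice of [ymin] only change the
    multiple of [d2]. *)
Lemma sample_points_plane n (f : 'cV[R]_n -> R) (xk d1 d2 ymin : 'cV[R]_n)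
    (Delta : R) :
  [set y1 xk Delta d2; y2 f xk Delta d2] ymin ->
  forall z, sample_points f xk Delta d1 d2 ymin z ->
  exists a b, z = xk + a *: d1 + b *: d2.
Proof.
have y1E : y1 xk Delta d2 = xk + Delta *: d2 by [].
have [c y2E] : exists c, y2 f xk Delta d2 = xk + c *: d2.
  rewrite /y2; case: ifP => _; first by exists (2 * Delta).
  by exists (- Delta); rewrite scaleNr.
move=> yminS.
have [e yminE] : exists e, ymin = xk + e *: d2.
  by case: yminS => ->; [exists Delta | exists c].
move=> z [[[->|->]|->]|->].
- by exists 0, 0; rewrite !scale0r !addr0.
- by exists 0, Delta; rewrite scale0r addr0.
- by exists 0, c; rewrite scale0r addr0.
- by exists Delta, e; rewrite /y3 yminE addrAC.
Qed.

Lemma ftilde_feasible n (f : 'cV[R]_n -> R) (xk d1 d2 ymin : 'cV[R]_n)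
    (Delta : R) :
  quadratic f -> orthonormal2 d1 d2 ->
  [set y1 xk Delta d2; y2 f xk Delta d2] ymin ->
  feasible f xk Delta d1 d2 ymin
    (fun u => ftilde f xk d1 d2 (u 0 0) (u 1 0)).
Proof.
move=> fq d12 yminS; split; last first.
  move=> z /(sample_points_plane yminS)[a [b ->]].
  by rewrite Tmap_plane// pair2E0 pair2E1.
(* The columns of [L] are [d1] and [d2], so [ftilde] is the pullback of [f] along the affine map
   [xk + L *m u]. *)
pose L : 'M[R]_(n, 2) := \matrix_(i, j) (if j == 0 then d1 i 0 else d2 i 0).
have [A [b [c fE]]] := quadratic_comp_affine xk L fq.
exists A, b, c => u; rewrite -fE /ftilde -addrA; congr (f (_ + _)).
apply/colP => i; rewrite !mxE big_ord_recl big_ord1 !mxE /=.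
(* [val_inj] identifies the index [1] of ['I_2] with the lifted index produced by [big_ord_recl]. *)
by rewrite mulrC [X in _ + X]mulrC; congr (_ + _ * u _ _); apply: val_inj.
Qed.

End QuadraticModels.

Theorem corollary4p5 (R : realType) (n : nat) (f : 'cV[R]_n -> R)
    (xk d1 d2 ymin : 'cV[R]_n) (Delta : R) (Qp Qk : 'cV[R]_2 -> R)
    (f_quadratic : quadratic f)
    (Delta_gt0 : 0 < Delta)
    (d_orthonormal : orthonormal2 d1 d2)
    (ymin_min : minimizer_on f [set y1 xk Delta d2; y2 f xk Delta d2] ymin)
    (Qp_prev : previous_model f xk d1 Qp)
    (Qk_sol : model_solution f xk Delta d1 d2 ymin Qp Qk) :
  (\int[lebesgue_measure]_(alpha in [set: R])
      (((Qk (pair2 alpha 0) - ftilde f xk d1 d2 alpha 0) ^+ 2)%:E) <=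
   \int[lebesgue_measure]_(alpha in [set: R])
      (((Qp (pair2 alpha 0) - ftilde f xk d1 d2 alpha 0) ^+ 2)%:E))%E.
Proof.
have axisE : (ftilde f xk d1 d2)^~ 0 = fun alpha => Qp (pair2 alpha 0).
  apply/funext => alpha.
  by rewrite (previous_model_axis f_quadratic Qp_prev) /ftilde scale0r addr0.
have := Qk_sol.2 _ (ftilde_feasible f_quadratic d_orthonormal ymin_min.1).
under [X in (_ <= sqdist X _)%E -> _]eq_fun do rewrite pair2E0 pair2E1.
(* Replacing [Qp] by [ftilde] on the axis turns both right-hand sides into the distance from
   [ftilde] to itself. *)
by rewrite -axisE -/(sqdist (fun alpha => Qk (pair2 alpha 0)) _)
  -/(sqdist (fun alpha => Qp (pair2 alpha 0)) _) -axisE.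
Qed.
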